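(* Let $p>3$ be a prime and let $\mathcal{O}=\mathbb{Z}[\omega]$ be an order in an imaginary quadratic field $K$. Every $\mathcal{O}$-oriented supersingular elliptic curve $(E,\iota)$ over $\overline{\mathbb{F}}_p$ admits an $\mathcal{O}$-twisting endomorphism.
   Context: $\operatorname{End}(E)$ denotes the full (geometric) endomorphism ring. Let $K$ be an imaginary quadratic field in which $p$ does not split. A $K$-orientation on a supersingular elliptic curve $E/\overline{\mathbb{F}}_p$ is an embedding $\iota:K\hookrightarrow\operatorname{End}(E)\otimes_{\mathbb{Z}}\mathbb{Q}$. It is $\mathcal{O}$-primitive, for an order $\mathcal{O}\subseteq K$, if $\iota(K)\cap\operatorname{End}(E)=\iota(\mathcal{O})$. An $\mathcal{O}$-oriented supersingular elliptic curve is a pair $(E,\iota)$ with $\iota$ an $\mathcal{O}$-primitive $K$-orientation on $E$. The conjugate orientation $\widehat{\iota}$ is defined by $\widehat{\iota}(x)=\iota(\overline{x})$ for all $x\in\mathcal{O}$, where $\overline{x}$ is the Galois conjugate of $x$. With $\mathcal{O}=\mathbb{Z}[\omega]$, an $\mathcal{O}$-twisting endomorphism of $(E,\iota)$ is an $\alpha\in\operatorname{End}(E)$ with $\widehat{\iota}(\omega)\circ\alpha=\alpha\circ\iota(\omega)$. *)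

(* Defs.v *)
From HB Require Import structures.
From mathcomp Require Import all_boot all_order all_algebra all_field.
From mathcomp Require Import all_fingroup generic_quotient.
From mathcomp Require Import boolp mpoly ring zify.

Set Implicit Arguments.
Unset Strict Implicit.
Unset Printing Implicit Defensive.

Import GRing.Theory Num.Theory.
Local Open Scope ring_scope.
Local Open Scope quotient_scope.

(* In characteristic different from 2 and 3 every elliptic curve is isomorphic
   to a short Weierstrass curve y^2 = x^3 + a x + b.  The discriminant is
   nonzero only if 2 is, so characteristic 2 is excluded. *)
Record weierstrass (k : fieldType) := Weierstrass {
  wa : k;
  wb : k;
  wdisc : - 16%:R * (4%:R * wa ^+ 3 + 27%:R * wb ^+ 2) != 0 }.

(* None is the point at infinity [0 : 1 : 0]. *)
Definition on_curve (k : fieldType) (E : weierstrass k) (P : option (k * k)) :=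
  if P is Some (x, y) then y ^+ 2 == x ^+ 3 + wa E * x + wb E else true.

Record point (k : fieldType) (E : weierstrass k) := Point {
  pval :> option (k * k);
  pvalP : on_curve E pval }.

HB.instance Definition _ k E := [isSub for @pval k E].
HB.instance Definition _ k E := [Choice of @point k E by <:].

Section RawGroupLaw.
Variables (k : fieldType) (E : weierstrass k).
Implicit Types P Q R : point E.
Local Notation a := (wa E).
Local Notation b := (wb E).

Definition raw_add (P Q : option (k * k)) : option (k * k) :=
  match P, Q with
  | None, _ => Q
  | _, None => P
  | Some (x1, y1), Some (x2, y2) =>
    if (x1 == x2) && (y1 == - y2) then None else
    let l := if x1 == x2 then (3%:R * x1 ^+ 2 + a) / (2%:R * y1)
             else (y1 - y2) / (x1 - x2) in
    let x3 := l ^+ 2 - x1 - x2 in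
    Some (x3, l * (x1 - x3) - y1)
  end.

Definition raw_opp (P : option (k * k)) : option (k * k) :=
  if P is Some (x, y) then Some (x, - y) else None.

Lemma two_neq0 : 2%:R != 0 :> k.
Proof.
apply/negP => /eqP h; move: (wdisc E).
have -> : 16%:R = 2%:R * 8%:R :> k by rewrite -natrM.
by rewrite h mul0r oppr0 mul0r eqxx.
Qed.

Lemma same_x x1 y1 x2 y2 : on_curve E (Some (x1, y1)) ->
  on_curve E (Some (x2, y2)) -> x1 = x2 -> (y1 == y2) || (y1 == - y2).
Proof.
move=> /= /eqP h1 /eqP h2 e; rewrite -eqf_sqr; apply/eqP.
by rewrite h1 h2 e.
Qed.

Lemma double_neq0 (x1 y1 x2 y2 : k) : on_curve E (Some (x1, y1)) ->
  on_curve E (Some (x2, y2)) -> x1 = x2 -> y1 != - y2 ->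
  y1 = y2 /\ y1 != 0.
Proof.
move=> h1 h2 e ne; have := same_x h1 h2 e; rewrite (negPf ne) orbF => /eqP h.
split=> //; apply: contra ne => /eqP y0; rewrite -h y0 oppr0; exact: eqxx.
Qed.

Lemma raw_addP P Q : on_curve E (raw_add P Q).
Proof.
case: P Q => [[[x1 y1]|] h1] [[[x2 y2]|] h2] //.
rewrite /raw_add /=; case: (eqVneq x1 x2) => [e|ne] /=.
  case: ifP => // /negbT ny; have [e2 y0] := double_neq0 h1 h2 e ny.
  move: h1 => /= /eqP h1; move: y0 two_neq0; rewrite -e => y0 t0.
  by apply/eqP; field: h1; rewrite t0 y0.
move: h1 h2 => /= /eqP h1 /eqP h2; apply/eqP.
have d : x1 - x2 != 0 by rewrite subr_eq0.
by field: h1 h2.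
Qed.

Lemma raw_oppP P : on_curve E (raw_opp P).
Proof. by case: P => [[[x y]|] h] //=; rewrite sqrrN. Qed.

Definition padd P Q := Point (raw_addP P Q).
Definition popp P := Point (raw_oppP P).
Definition pzero := @Point k E None isT.

Lemma paddC : commutative padd.
Proof.
move=> [[[x1 y1]|] h1] [[[x2 y2]|] h2]; apply: val_inj => //=.
rewrite (eq_sym x2) [y2 == _]eq_sym eqr_oppLR.
case: (eqVneq x1 x2) => [e|ne] /=.
  case: ifP => // /negbT ny; have [e2 y0] := double_neq0 h1 h2 e ny.
  by rewrite -e -e2.
have d : x1 - x2 != 0 by rewrite subr_eq0.
have d' : x2 - x1 != 0 by rewrite subr_eq0 eq_sym.
have -> : (y2 - y1) / (x2 - x1) = (y1 - y2) / (x1 - x2).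
  by field; rewrite d d'.
congr (Some (_, _)); first by rewrite addrAC.
by field; rewrite ?d.
Qed.

Lemma add0p : left_id pzero padd.
Proof. by move=> [[[x y]|] h]; apply: val_inj. Qed.

Lemma addNp : left_inverse pzero popp padd.
Proof. by move=> [[[x y]|] h]; apply: val_inj => //=; rewrite !eqxx. Qed.

Lemma paddA_generic (x1 y1 x2 y2 x3 y3 : k) h1 h2 h3
    (P := @Point k E (Some (x1, y1)) h1) (Q := @Point k E (Some (x2, y2)) h2)
    (R := @Point k E (Some (x3, y3)) h3) :
  x1 != x2 -> x2 != x3 ->
  (forall y, pval (padd P Q) != Some (x3, y)) ->
  (forall y, pval (padd Q R) != Some (x1, y)) ->
  padd P (padd Q R) = padd (padd P Q) R.
Proof.
move=> n1 n2; rewrite {}/P {}/Q {}/R /= (negPf n1) (negPf n2) /=.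
set l := (y1 - y2) / _; set m := (y2 - y3) / _.
move=> n3 n4; apply: val_inj => /=; rewrite (negPf n1) (negPf n2) /=.
have d1 : x1 - x2 != 0 by rewrite subr_eq0.
have d2 : x2 - x3 != 0 by rewrite subr_eq0.
have e3 : l ^+ 2 - x1 - x2 != x3.
  by apply: contra (n3 (l * (x1 - (l ^+ 2 - x1 - x2)) - y1)) => /eqP {1}<-.
have e4 : x1 != m ^+ 2 - x2 - x3.
  rewrite eq_sym.
  by apply: contra (n4 (m * (x2 - (m ^+ 2 - x2 - x3)) - y2)) => /eqP {1}<-.
rewrite -/l -/m (negPf e3) (negPf e4) /=.
have {n3 n4} d3 : l ^+ 2 - x1 - x2 - x3 != 0 by rewrite subr_eq0.
have {e3 e4} d4 : x1 - (m ^+ 2 - x2 - x3) != 0 by rewrite subr_eq0.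
move: h1 h2 h3 => /= /eqP h1 /eqP h2 /eqP h3.
have side (A B D : k) : D != 0 -> A = B * D ^+ 2 -> B != 0 -> A != 0.
  by move=> D0 -> B0; rewrite mulf_neq0 ?expf_neq0.
have s1 : (y1 - y2) ^+ 2 + - x1 * (x1 - x2) ^+ 2 + - x2 * (x1 - x2) ^+ 2 +
    - x3 * (x1 - x2) ^+ 2 != 0.
  by apply: (side _ _ _ d1 _ d3); rewrite /l; field; exact: d1.
have s2 : x1 * (x2 - x3) ^+ 2 -
    ((y2 - y3) ^+ 2 + - x2 * (x2 - x3) ^+ 2 + - x3 * (x2 - x3) ^+ 2) != 0.
  by apply: (side _ _ _ d2 _ d4); rewrite /m; field; exact: d2.
by rewrite /l /m; congr (Some (_, _)); field: h1 h2 h3; rewrite d1 d2 s1 s2.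
Qed.

Lemma paddK (x1 y1 x2 y2 x3 y3 : k) h1 h2 h3
    (P := @Point k E (Some (x1, y1)) h1) (Q := @Point k E (Some (x2, y2)) h2)
    (R := @Point k E (Some (x3, y3)) h3) :
  x1 != x2 -> x3 != x1 -> padd P Q = R -> padd R (popp P) = Q.
Proof.
move=> n12 n31 /(congr1 (@pval k E)) /=; rewrite (negPf n12) /= => -[e3 ey].
apply: val_inj => /=; rewrite (negPf n31) /=.
move: e3 ey; set l := (y1 - y2) / _ => e3 ey.
have d12 : x1 - x2 != 0 by rewrite subr_eq0.
have d31 : x3 - x1 != 0 by rewrite subr_eq0.
have -> : (y3 - - y1) / (x3 - x1) = - l.
  by rewrite -ey; apply: (mulIf d31); rewrite divfK // -e3; ring.
have el : l * (x1 - x2) = y1 - y2 by rewrite /l divfK.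
have -> : (- l) ^+ 2 - x3 - x1 = x2 by rewrite -e3; ring.
congr (Some (_, _)); rewrite -ey.
have -> : y2 = y1 - l * (x1 - x2) by rewrite el; ring.
by rewrite -e3; ring.
Qed.

End RawGroupLaw.

Definition triple (T : Type) (x y z : T) : 'I_3 -> T := tnth [tuple x; y; z].

Lemma tripleE (T : Type) (x y z : T) : ((triple x y z 0 = x) *
  (triple x y z 1 = y) * (triple x y z 2%:R = z))%type.
Proof. by rewrite /triple !(tnth_nth x). Qed.

Section Regular.
Variables (k : fieldType) (E : weierstrass k).
Implicit Types (P Q R : point E) (f g : point E -> point E).
Local Notation a := (wa E).
Local Notation b := (wb E).

Definition coords (P : option (k * k)) : 'I_3 -> k :=
  if P is Some (x, y) then triple x y 1 else triple 0 1 0.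

(* f is given near P by forms F 0, F 1, F 2 of the same degree without common
   zero at P; wherever the forms are not all zero, [F 0 : F 1 : F 2] = f. *)
Definition regular_at f P :=
  exists (d : nat) (F : 'I_3 -> {mpoly k[3]}),
    [/\ forall i, F i \is d.-homog,
        exists i, (F i).@[coords P] != 0 &
        forall Q, exists c, forall i, (F i).@[coords Q] = c * coords (f Q) i].

Definition regular f := forall P, regular_at f P.

Arguments coords : simpl never.

Lemma I3P (T : 'I_3 -> Prop) : T 0 -> T 1 -> T 2%:R -> forall i, T i.
Proof.
move=> T0 T1 T2 [[|[|[|//]]] h].
- by rewrite (_ : Ordinal h = 0) //; apply: val_inj.
- by rewrite (_ : Ordinal h = 1) //; apply: val_inj.
- by rewrite (_ : Ordinal h = 2%:R) //; apply: val_inj.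
Qed.

Lemma coords_neq0 (P : option (k * k)) : exists i, coords P i != 0.
Proof.
case: P => [[x y]|]; [exists (2%:R : 'I_3)|exists (1 : 'I_3)];
by rewrite /coords tripleE oner_eq0.
Qed.

Lemma coordsE x y : ((coords (Some (x, y)) 0 = x) *
  (coords (Some (x, y)) 1 = y) * (coords (Some (x, y)) 2%:R = 1))%type.
Proof. by rewrite /coords !tripleE. Qed.

Lemma coords0E : ((coords None 0 = 0) *
  (coords None 1 = 1) * (coords None 2%:R = 0))%type.
Proof. by rewrite /coords !tripleE. Qed.

Lemma coords_inj (P Q : option (k * k)) (c c' : k) : c != 0 ->
  (forall i, c * coords P i = c' * coords Q i) -> P = Q.
Proof.
move=> c0; case: P Q => [[x y]|] [[x' y']|] h //.
- have := h 2%:R; rewrite !coordsE !mulr1 => e; move: (h 0) (h 1).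
  by rewrite !coordsE -e => /(mulfI c0) -> /(mulfI c0) ->.
- have /eqP := h 2%:R; rewrite coordsE coords0E mulr1 mulr0 (negPf c0) //.
have := h 2%:R; rewrite coordsE coords0E mulr1 mulr0 => e.
have /eqP := h 1; rewrite -e mul0r coords0E mulr1 (negPf c0) //.
Qed.

(* The two addition laws of bidegree (2, 2) of Bosma and Lenstra: the first
   vanishes exactly when P - Q is affine with y = 0, the second exactly when
   P = Q. *)
Definition add_law1_aux (R : comNzRingType) (a b xx yy zz xy xz yz : R) :=
  triple
    (xy * (yy - a * xz - (b * zz) *+ 3)
     - yz * (a * xx + (b * xz) *+ 3 - a * (a * zz)))
    ((xx *+ 3 + a * zz) * (a * xx + (b * xz) *+ 3 - a * (a * zz))
     + (yy + a * xz + (b * zz) *+ 3) * (yy - a * xz - (b * zz) *+ 3))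
    (yz * (yy + a * xz + (b * zz) *+ 3) + xy * (xx *+ 3 + a * zz)).

Definition add_law1 (R : comNzRingType) (a b : R) (u v : 'I_3 -> R) :=
  add_law1_aux a b (u 0 * v 0) (u 1 * v 1) (u 2%:R * v 2%:R)
    (u 0 * v 1 + u 1 * v 0) (u 0 * v 2%:R + u 2%:R * v 0)
    (u 1 * v 2%:R + u 2%:R * v 1).

Definition add_law2 (R : comNzRingType) (a b : R) (u v : 'I_3 -> R) :=
  let xy' := u 0 * v 1 - u 1 * v 0 in
  let xz := u 0 * v 2%:R + u 2%:R * v 0 in
  let xz' := u 0 * v 2%:R - u 2%:R * v 0 in
  let yz := u 1 * v 2%:R + u 2%:R * v 1 in
  let yz' := u 1 * v 2%:R - u 2%:R * v 1 in
  let xx := u 0 * v 0 in let yy := u 1 * v 1 in let zz := u 2%:R * v 2%:R in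
  triple (xy' * yz + xz' * yy - (a * xz) * xz' - (b * xz') * zz *+ 3)
    (- (xx * xy') *+ 3 - yy * yz' - (a * xy') * zz + (a * xz) * yz'
      + (b * yz') * zz *+ 3)
    ((xx * xz') *+ 3 - yz * yz' + (a * xz') * zz).

Lemma add_law1P P Q : exists c, forall i,
  add_law1 a b (coords P) (coords Q) i = c * coords (padd P Q) i.
Proof.
case: P Q => [[[x1 y1]|] h1] [[[x2 y2]|] h2].
- have t0 := two_neq0 E.
  rewrite [pval (padd _ _)]/=; case: (eqVneq x1 x2) => [e|ne] /=.
    case: ifP => [/eqP e2|/negbT ny].
      rewrite /add_law1 /add_law1_aux /= !coordsE; subst.
      exists (add_law1 a b (coords (Some (x2, - y2))) (coords (Some (x2, y2))) 1).
      apply: I3P; rewrite /add_law1 /add_law1_aux /= !coordsE !coords0E !tripleE; ring.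
    have [e2 y0] := double_neq0 h1 h2 e ny; subst.
    move: h1 => /= /eqP h1; exists (8%:R * y2 ^+ 3).
    by apply: I3P; rewrite /add_law1 /add_law1_aux /= !coordsE !tripleE; field: h1;
      rewrite ?t0 ?y0.
  have d : x1 - x2 != 0 by rewrite subr_eq0.
  exists (add_law1 a b (coords (Some (x1, y1))) (coords (Some (x2, y2))) 2%:R).
  move: h1 h2 => /= /eqP h1 /eqP h2.
  by apply: I3P; rewrite /add_law1 /add_law1_aux /= !coordsE !tripleE; field: h1 h2.
- exists (y1 * 1).
  by apply: I3P; rewrite /add_law1 /add_law1_aux /= !coordsE !coords0E !tripleE; ring.
- exists (y2 * 1).
  by apply: I3P; rewrite /add_law1 /add_law1_aux /= !coordsE !coords0E !tripleE; ring.
exists 1.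
by apply: I3P; rewrite /add_law1 /add_law1_aux /= !coords0E !tripleE; ring.
Qed.

Lemma add_law2P P Q : exists c, forall i,
  add_law2 a b (coords P) (coords Q) i = c * coords (padd P Q) i.
Proof.
case: P Q => [[[x1 y1]|] h1] [[[x2 y2]|] h2].
- rewrite [pval (padd _ _)]/=; case: (eqVneq x1 x2) => [e|ne] /=.
    case: ifP => [/eqP e2|/negbT ny].
      subst.
      exists (add_law2 a b (coords (Some (x2, - y2))) (coords (Some (x2, y2))) 1).
      by apply: I3P; rewrite /add_law2 /= !coordsE !coords0E !tripleE; ring.
    have [e2 y0] := double_neq0 h1 h2 e ny; subst; exists 0.
    by apply: I3P; rewrite /add_law2 /= !coordsE !tripleE; ring.
  have d : x1 - x2 != 0 by rewrite subr_eq0.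
  exists (- (x1 - x2) ^+ 3); move: h1 h2 => /= /eqP h1 /eqP h2.
  by apply: I3P; rewrite /add_law2 /= !coordsE !tripleE; field: h1 h2.
- exists 1.
  by apply: I3P; rewrite /add_law2 /= !coordsE !coords0E !tripleE; ring.
- exists (- 1).
  by apply: I3P; rewrite /add_law2 /= !coordsE !coords0E !tripleE; ring.
exists 0.
by apply: I3P; rewrite /add_law2 /= !coords0E !tripleE; ring.
Qed.

Lemma add_law_neq0 P Q :
  (exists i, add_law1 a b (coords P) (coords Q) i != 0) \/
  (exists i, add_law2 a b (coords P) (coords Q) i != 0).
Proof.
have t0 := two_neq0 E.
case: P Q => [[[x1 y1]|] h1] [[[x2 y2]|] h2].
- case: (eqVneq x1 x2) => [e|ne] /=.
    case: (eqVneq y1 0) => y0.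
      left; exists 1; have := same_x h2 h1 (esym e).
      rewrite y0 oppr0 orbb => /eqP y20; subst.
      move: h1 => /= /eqP h1; rewrite /add_law1 /add_law1_aux /= !coordsE !tripleE.
      set A := (X in X != 0).
      have -> : A = - (3%:R * x2 ^+ 2 + a) ^+ 3.
        have bE : b = - (x2 ^+ 3 + a * x2).
          by apply: (addrI (x2 ^+ 3 + a * x2)); rewrite -h1 subrr expr0n.
        by rewrite /A bE; ring.
      rewrite oppr_eq0 expf_neq0 //; apply/negP => /eqP q0.
      have aE : a = - (3%:R * x2 ^+ 2) by apply/eqP; rewrite -addr_eq0 addrC q0.
      have bE : b = 2%:R * x2 ^+ 3.
        have -> : b = x2 ^+ 3 + a * x2 + b - (x2 ^+ 3 + a * x2) by ring.
        by rewrite -h1 aE; ring.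
      by have /negP := wdisc E; apply; apply/eqP; rewrite aE bE; ring.
    have := same_x h2 h1 (esym e); case/orP => /eqP ey; subst.
      left; exists 2%:R; move: h1 => /= /eqP h1.
      rewrite /add_law1 /add_law1_aux /= !coordsE !tripleE.
      set A := (X in X != 0); have -> : A = 2%:R ^+ 3 * y1 ^+ 3.
        by rewrite /A; ring: h1.
      by rewrite mulf_neq0 ?expf_neq0.
    right; exists 1; move: h1 => /= /eqP h1.
    rewrite /add_law2 /= !coordsE !tripleE.
    set A := (X in X != 0); have -> : A = 2%:R ^+ 3 * y1 ^+ 3.
      by rewrite /A; ring: h1.
    by rewrite mulf_neq0 ?expf_neq0.
  right; exists 2%:R; move: h1 h2 => /= /eqP h1 /eqP h2.
  rewrite /add_law2 /= !coordsE !tripleE.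
  set A := (X in X != 0); have -> : A = - (x1 - x2) ^+ 3.
    by rewrite /A; ring: h1 h2.
  by rewrite oppr_eq0 expf_neq0 // subr_eq0.
- right; exists 2%:R; rewrite /add_law2 /= !coordsE !coords0E !tripleE.
  set A := (X in X != 0); have -> : A = 1 by rewrite /A; ring.
  exact: oner_neq0.
- right; exists 2%:R; rewrite /add_law2 /= !coordsE !coords0E !tripleE.
  set A := (X in X != 0); have -> : A = - 1 by rewrite /A; ring.
  by rewrite oppr_eq0 oner_neq0.
left; exists 1; rewrite /add_law1 /add_law1_aux /= !coords0E !tripleE.
set A := (X in X != 0); have -> : A = 1 by rewrite /A; ring.
exact: oner_neq0.
Qed.

Local Ltac prove_form cst := repeat lazymatch goal with
  | |- is_true (in_mem (_ + _) _) => apply: rpredD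
  | |- is_true (in_mem (- _) _) => rewrite rpredN
  | |- is_true (in_mem (_ *+ _) _) => apply: rpredMn
  | |- is_true (in_mem (_%:MP * _) _) => apply: (cst)
  | |- is_true (in_mem (_ * _) _) => apply: dhomogM
  | _ => done
  end.

Lemma add_law_homog d e (u v : 'I_3 -> {mpoly k[3]}) :
  (forall i, u i \is d.-homog) -> (forall i, v i \is e.-homog) ->
  (forall i, add_law1 a%:MP b%:MP u v i \is (d + e + (d + e)).-homog) /\
  (forall i, add_law2 a%:MP b%:MP u v i \is (d + e + (d + e)).-homog).
Proof.
move=> hu hv.
have uv i j : u i * v j \is (d + e).-homog by apply: dhomogM.
have cst (c : k) n p : p \is n.-homog -> c%:MP * p \is n.-homog.
  by move=> hp; rewrite mul_mpolyC; apply: rpredZ.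
rewrite /add_law1 /add_law2.
move: (uv 0 0) (uv 0 1) (uv 0 2%:R) (uv 1 0) (uv 1 1) (uv 1 2%:R) (uv 2%:R 0)
  (uv 2%:R 1) (uv 2%:R 2%:R) => {uv hu hv}.
move: (u 0 * v 0) (u 0 * v 1) (u 0 * v 2%:R) (u 1 * v 0) (u 1 * v 1)
  (u 1 * v 2%:R) (u 2%:R * v 0) (u 2%:R * v 1) (u 2%:R * v 2%:R).
move: (d + e)%N => n q00 q01 q02 q10 q11 q12 q20 q21 q22 h00 h01 h02 h10 h11 h12.
move=> h20 h21 h22; split; apply: I3P;
  rewrite ?/add_law1_aux !tripleE; prove_form cst.
Qed.

Lemma meval_add_law (u v : 'I_3 -> {mpoly k[3]}) w i :
  ((add_law1 a%:MP b%:MP u v i).@[w]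
     = add_law1 a b (fun i => (u i).@[w]) (fun i => (v i).@[w]) i) *
  ((add_law2 a%:MP b%:MP u v i).@[w]
     = add_law2 a b (fun i => (u i).@[w]) (fun i => (v i).@[w]) i).
Proof.
by split; move: i; apply: I3P;
  rewrite ?/add_law1 ?/add_law1_aux ?/add_law2 !tripleE;
  rewrite ?(mevalD, mevalB, mevalN, mevalM, mevalMn, mevalC).
Qed.

Lemma add_law_scale (c c' : k) (u u' v v' : 'I_3 -> k) i :
  (forall i, u i = c * u' i) -> (forall i, v i = c' * v' i) ->
  (add_law1 a b u v i = (c * c') ^+ 2 * add_law1 a b u' v' i) *
  (add_law2 a b u v i = (c * c') ^+ 2 * add_law2 a b u' v' i).
Proof.
move=> hu hv.
by split; move: i; apply: I3P;
  rewrite ?/add_law1 ?/add_law1_aux ?/add_law2 !tripleE !hu !hv; ring.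
Qed.

Lemma regular_add f g : regular f -> regular g ->
  regular (fun P => padd (f P) (g P)).
Proof.
move=> rf rg P; have [d [F [hF [i Fi] vF]]] := rf P.
have [e [G [hG [j Gj] vG]]] := rg P.
have [hom1 hom2] := add_law_homog hF hG.
have [c cE] := vF P; have [c' c'E] := vG P.
have c0 : c != 0 by apply: contraNneq Fi => c1; rewrite cE c1 mul0r.
have c'0 : c' != 0 by apply: contraNneq Gj => c1; rewrite c'E c1 mul0r.
have [[l hl]|[l hl]] := add_law_neq0 (f P) (g P).
- exists (d + e + (d + e))%N, (add_law1 a%:MP b%:MP F G); split=> //.
    exists l; rewrite meval_add_law (add_law_scale _ cE c'E).
    by rewrite mulf_neq0 // expf_neq0 // mulf_neq0.
  move=> Q; have [x xE] := vF Q; have [y yE] := vG Q.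
  have [z zE] := add_law1P (f Q) (g Q); exists ((x * y) ^+ 2 * z) => m.
  by rewrite meval_add_law (add_law_scale _ xE yE) zE mulrA.
exists (d + e + (d + e))%N, (add_law2 a%:MP b%:MP F G); split=> //.
  exists l; rewrite meval_add_law (add_law_scale _ cE c'E).
  by rewrite mulf_neq0 // expf_neq0 // mulf_neq0.
move=> Q; have [x xE] := vF Q; have [y yE] := vG Q.
have [z zE] := add_law2P (f Q) (g Q); exists ((x * y) ^+ 2 * z) => m.
by rewrite meval_add_law (add_law_scale _ xE yE) zE mulrA.
Qed.

Lemma regular_id : regular id.
Proof.
move=> P; exists 1%N, (fun i => 'X_i); split.
- by move=> i; rewrite dhomogX /= mdeg1.
- by have [i hi] := coords_neq0 P; exists i; rewrite mevalXU.
by move=> Q; exists 1 => i; rewrite mevalXU mul1r.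
Qed.

Lemma regular_cst R : regular (fun=> R).
Proof.
move=> P; exists 0%N, (fun i => (coords R i)%:MP); split.
- by move=> i; rewrite -[_%:MP]mulr1 mul_mpolyC rpredZ // dhomog1.
- by have [i hi] := coords_neq0 R; exists i; rewrite mevalC.
by move=> Q; exists 1 => i; rewrite mevalC mul1r.
Qed.

Lemma regular_opp f : regular f -> regular (fun P => popp (f P)).
Proof.
move=> rf P; have [d [F [hF [i Fi] vF]]] := rf P.
have oppE Q c : (forall i, (F i).@[coords Q] = c * coords (f Q) i) ->
    exists c', forall i, (triple (F 0) (- F 1) (F 2%:R) i).@[coords Q]
      = c' * coords (popp (f Q)) i.
  move=> cE; case eQ: (f Q) cE => [[[x y]|] h] cE.
    exists c; move: (cE 0) (cE 1) (cE 2%:R); rewrite !coordsE => e0 e1 e2.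
    apply: I3P; rewrite !tripleE ?mevalN.
    + exact: e0. + by rewrite e1 mulrN. + exact: e2.
  exists (- c); move: (cE 0) (cE 1) (cE 2%:R); rewrite !coords0E => e0 e1 e2.
  apply: I3P; rewrite !tripleE ?mevalN.
  + by rewrite e0 !mulr0. + by rewrite e1 mulNr. + by rewrite e2 !mulr0.
exists d, (triple (F 0) (- F 1) (F 2%:R)); split.
- by apply: I3P; rewrite tripleE ?rpredN.
- exists i; move: i Fi; apply: I3P; rewrite tripleE ?mevalN //.
  by rewrite oppr_eq0.
by move=> Q; have [c cE] := vF Q; apply: oppE cE.
Qed.

Lemma dhomog_scale d (p : {mpoly k[3]}) (c : k) (v : 'I_3 -> k) :
  p \is d.-homog -> p.@[fun i => c * v i] = c ^+ d * p.@[v].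
Proof.
move=> /dhomogP hp; rewrite !mevalE mulr_sumr big_seq [RHS]big_seq.
apply: eq_bigr => m /hp /= <-; rewrite mulrCA; congr (_ * _).
rewrite mdegE -prodrXr -big_split /=; apply: eq_bigr => i _.
by rewrite exprMn.
Qed.

Lemma dhomog_comp d e (p : {mpoly k[3]}) (F : 3.-tuple {mpoly k[3]}) :
  p \is d.-homog -> (forall i, tnth F i \is e.-homog) ->
  p \mPo F \is (d * e).-homog.
Proof.
move=> /dhomogP hp hF; rewrite comp_mpolyE big_seq rpred_sum // => m /hp /= <-.
apply: rpredZ; rewrite mdegE big_distrl /=.
apply: (big_ind2 (fun (q : {mpoly k[3]}) n => q \is n.-homog)).
- exact: dhomog1.
- by move=> ? ? ? ?; apply: dhomogM.
by move=> i _; rewrite mulnC; apply: dhomogMn.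
Qed.

Lemma regular_comp f g : regular f -> regular g -> regular (f \o g).
Proof.
move=> rf rg P; have [e [G [hG [j Gj] vG]]] := rg P.
have [d [F [hF [i Fi] vF]]] := rf (g P).
have evalE l Q c : (forall i, (G i).@[coords Q] = c * coords (g Q) i) ->
    (F l \mPo [tuple G i | i < 3]).@[coords Q]
    = c ^+ d * (F l).@[coords (g Q)].
  move=> cE; rewrite comp_mpoly_meval -(dhomog_scale _ _ (hF l)).
  by apply: meval_eq => m; rewrite tnth_mktuple cE.
exists (d * e)%N, (fun l => F l \mPo [tuple G i | i < 3]).
split.
- by move=> l; apply: dhomog_comp => // m; rewrite tnth_mktuple.
- exists i; have [c cE] := vG P; rewrite (evalE _ _ _ cE).
  have c0 : c != 0 by apply: contraNneq Gj => c1; rewrite cE c1 mul0r.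
  by rewrite mulf_neq0 // expf_neq0.
move=> Q; have [c cE] := vG Q; have [c' c'E] := vF (g Q).
by exists (c ^+ d * c') => l; rewrite (evalE _ _ _ cE) c'E mulrA.
Qed.

End Regular.

Section Density.
Variables (k : closedFieldType) (E : weierstrass k).
Implicit Types (P Q R : point E) (f g : point E -> point E).
Local Notation a := (wa E).
Local Notation b := (wb E).

Lemma closed_infinite (s : seq k) : exists x, x \notin s.
Proof.
have [|x /rootP] := closed_rootP (\prod_(y <- s) ('X - y%:P) * 'X + 1) _.
  case: s => [|y s]; first by rewrite big_nil mul1r -[1]/(1%:P) size_XaddC.
  set q := \prod_(_ <- _) _; have q0 : q != 0.
    by rewrite monic_neq0 // monic_prod_XsubC.
  rewrite size_polyDl size_mulX // size_prod_XsubC //= size_poly1 //.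
rewrite hornerD hornerMX hornerC => e; exists x; apply/negP => xs.
have : root (\prod_(y <- s) ('X - y%:P)) x by rewrite root_prod_XsubC.
by move=> /rootP h; move/eqP: e; rewrite h mul0r add0r oner_eq0.
Qed.

Lemma poly_eq0_cofinite (p : {poly k}) (s : seq k) :
  (forall x, x \notin s -> p.[x] = 0) -> p = 0.
Proof.
move=> h; apply/eqP/negP => /negP p0.
have q0 : \prod_(y <- s) ('X - y%:P) * p != 0.
  by rewrite mulf_neq0 // monic_neq0 // monic_prod_XsubC.
suff : \prod_(y <- s) ('X - y%:P) * p = 0 by move/eqP; rewrite (negPf q0).
set q := _ * p in q0 *; have qx x : q.[x] = 0.
  rewrite hornerM; have [xs|xs] := boolP (x \in s); last by rewrite h // mulr0.
  have : root (\prod_(y <- s) ('X - y%:P)) x by rewrite root_prod_XsubC.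
  by move/rootP->; rewrite mul0r.
have /closed_nonrootP [x] := q0; by rewrite /root qx eqxx.
Qed.

Lemma curve_poly (h : {mpoly k[3]}) : exists A B : {poly k},
  forall x y, on_curve E (Some (x, y)) ->
    h.@[coords (Some (x, y))] = A.[x] + B.[x] * y.
Proof.
pose T (h : {mpoly k[3]}) := exists A B : {poly k},
  forall x y, on_curve E (Some (x, y)) ->
    h.@[coords (Some (x, y))] = A.[x] + B.[x] * y.
rewrite -/(T h).
have TD p q : T p -> T q -> T (p + q).
  move=> [A [B hp]] [A' [B' hq]]; exists (A + A'), (B + B') => x y hxy.
  by rewrite mevalD hp // hq // !hornerD; ring.
have TC c : T c%:MP.
  by exists c%:P, 0 => x y _; rewrite mevalC !(hornerD, hornerM, hornerZ, hornerC, hornerX, hornerXn, horner0) mul0r addr0.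
have TX i : T 'X_i.
  move: i; apply: I3P.
  - by exists 'X, 0 => x y _; rewrite mevalXU coordsE !(hornerD, hornerM, hornerZ, hornerC, hornerX, hornerXn, horner0) mul0r addr0.
  - by exists 0, 1%:P => x y _; rewrite mevalXU coordsE !(hornerD, hornerM, hornerZ, hornerC, hornerX, hornerXn, horner0) add0r mul1r.
  by exists 1%:P, 0 => x y _; rewrite mevalXU coordsE !(hornerD, hornerM, hornerZ, hornerC, hornerX, hornerXn, horner0) mul0r addr0.
have TM p q : T p -> T q -> T (p * q).
  move=> [A [B hp]] [A' [B' hq]].
  exists (A * A' + B * B' * ('X^3 + a *: 'X + b%:P)), (A * B' + A' * B).
  move=> x y hxy; rewrite mevalM hp // hq // !(hornerD, hornerM, hornerZ, hornerC, hornerX, hornerXn).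
  by move: hxy => /= /eqP hxy; ring: hxy.
rewrite [h]mpolyE; apply: (big_ind T); [|exact: TD|].
  by rewrite -mpolyC0; apply: (TC).
move=> m _; rewrite -mul_mpolyC; apply: (TM) => //.
rewrite mpolyXE_id; apply: (big_ind T); [|exact: TM|]; first by rewrite -mpolyC1; apply: (TC).
move=> i _; elim: (m i) => [|n IH]; first by rewrite expr0 -mpolyC1; apply: (TC).
by rewrite exprS; apply: (TM).
Qed.

Lemma vanish_dense (h : {mpoly k[3]}) (s : seq k) :
  (forall x y, on_curve E (Some (x, y)) -> x \notin s ->
     h.@[coords (Some (x, y))] = 0) ->
  forall x y, on_curve E (Some (x, y)) -> h.@[coords (Some (x, y))] = 0.
Proof.
have [A [B hE]] := curve_poly h => hs x y hxy; rewrite hE //.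
have root_y (z : k) : exists y, on_curve E (Some (z, y)).
  have [|w /rootP] := closed_rootP ('X^2 - (z ^+ 3 + a * z + b)%:P) _.
    by rewrite size_XnsubC.
  rewrite hornerD hornerN hornerXn hornerC => /eqP; rewrite subr_eq0 => e.
  by exists w => /=; rewrite -(eqP e).
have AB (z : k) : z \notin s -> A.[z] = 0 /\
    (B.[z] = 0 \/ z ^+ 3 + a * z + b = 0).
  move=> zs; have [w hw] := root_y z.
  have h1 := hs _ _ hw zs.
  have hw' : on_curve E (Some (z, - w)) by rewrite /= sqrrN.
  have h2 := hs _ _ hw' zs; rewrite hE // in h1; rewrite hE // mulrN in h2.
  have A0 : A.[z] = 0.
    apply: (mulfI (two_neq0 E)); rewrite mulr0 -[0]addr0 -{1}h1 -h2; ring.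
  split=> //; move: h1; rewrite A0 add0r => /eqP; rewrite mulf_eq0.
  case/orP => /eqP; [by left | move=> w0; right].
  by move: hw => /= /eqP <-; rewrite w0 expr0n.
have -> : A = 0 by apply: (@poly_eq0_cofinite _ s) => z /AB [].
have /eqP : B * ('X^3 + a *: 'X + b%:P) = 0.
  apply: (@poly_eq0_cofinite _ s) => z /AB [_ h0].
  by rewrite !(hornerD, hornerM, hornerZ, hornerC, hornerX, hornerXn, horner0); case: h0 => ->; rewrite ?mul0r ?mulr0.
rewrite mulf_eq0 => /orP[/eqP->|]; first by rewrite !horner0 mul0r addr0.
suff /negPf -> : 'X^3 + a *: 'X + b%:P != 0 :> {poly k} by [].
apply/negP => /eqP /(congr1 (fun p : {poly k} => p`_3)).
by rewrite !coefE /= mulr0 !addr0 => /eqP; rewrite oner_eq0.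
Qed.

Lemma regular_dense f g (s : seq k) : regular f -> regular g ->
  (forall P x y, pval P = Some (x, y) -> x \notin s -> f P = g P) ->
  forall P x y, pval P = Some (x, y) -> f P = g P.
Proof.
move=> rf rg hs P x y eP.
have [d [F [hF [i Fi] vF]]] := rf P; have [e [G [hG [j Gj] vG]]] := rg P.
have [c cE] := vF P; have [c' c'E] := vG P.
have c0 : c != 0 by apply: contraNneq Fi => c1; rewrite cE c1 mul0r.
have c'0 : c' != 0 by apply: contraNneq Gj => c1; rewrite c'E c1 mul0r.
have minor m n : coords (f P) m * coords (g P) n
    = coords (f P) n * coords (g P) m.
  have : (F m * G n - F n * G m).@[coords (pval P)] = 0.
    have hP : on_curve E (Some (x, y)) by rewrite -eP pvalP.
    rewrite eP; apply: (@vanish_dense _ s) => // z w hzw zs.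
    have [c1 c1E] := vF (Point hzw); have [c2 c2E] := vG (Point hzw).
    have fg := hs (Point hzw) z w erefl zs.
    by rewrite mevalB !mevalM !c1E !c2E fg; ring.
  rewrite mevalB !mevalM !cE !c'E => e0; apply: (mulfI c0); apply: (mulfI c'0).
  by apply/eqP; rewrite -subr_eq0 -[X in _ == X]e0; apply/eqP; ring.
apply: val_inj => /=.
have [l hl] := coords_neq0 (pval (g P)).
apply: (@coords_inj k _ _ (coords (g P) l) (coords (f P) l)) => // m.
by rewrite mulrC -minor.
Qed.

End Density.

Section GroupLaw.
Variables (k : closedFieldType) (E : weierstrass k).
Implicit Types P Q R : point E.

Definition xcoord P := if pval P is Some (x, _) then x else 0.

Lemma regular_addl P : regular (padd P).
Proof. exact: regular_add (regular_cst P) (@regular_id _ E). Qed.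

Lemma paddA_distinct P Q R (x1 y1 x2 y2 : k) : pval P = Some (x1, y1) ->
  pval Q = Some (x2, y2) -> x1 != x2 ->
  padd P (padd Q R) = padd (padd P Q) R.
Proof.
move=> eP eQ n12.
case eR: (pval R) => [[x3 y3]|]; last first.
  have -> : R = pzero E by apply: val_inj.
  by rewrite ![padd _ (pzero E)]paddC !add0p.
pose s := [:: x2; xcoord (padd P Q); xcoord (padd P (popp Q));
              xcoord (padd (popp P) (popp Q))].
apply: (@regular_dense _ E (fun R => padd P (padd Q R))
  (fun R => padd (padd P Q) R) s _ _ _ R x3 y3 eR).
- exact: regular_add (regular_cst P) (regular_addl Q).
- exact: regular_addl.
move=> {x3 y3 eR}R x3 y3 eR; rewrite !inE !negb_or => /and4P[n32 n3PQ n3m n3p].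
case: P Q R eP eQ eR @s n3PQ n3m n3p => [p hP] [q hQ] [r hR] /= eP eQ eR.
subst; rewrite /xcoord => n3PQ n3m n3p.
apply: paddA_generic => //; first by rewrite eq_sym.
  move=> y; apply/negP => /eqP e.
  by move: n3PQ; rewrite e eqxx.
move=> y; apply/negP => /eqP e.
set Q := Point hQ in n3PQ n3m n3p e *; set R := Point hR in e *.
have hT : on_curve E (Some (x1, y)) by rewrite -e pvalP.
have eT : padd Q R = Point hT by apply: val_inj.
have eK := @paddK _ E _ _ _ _ _ _ hQ hR hT _ n12 eT.
have {}eK : padd (Point hT) (popp Q) = R by apply: eK; rewrite eq_sym.
have /orP[/eqP ey|/eqP ey] := same_x hT hP erefl; subst.
- have e1 : Point hT = Point hP by apply: val_inj.
  by move: n3m; rewrite -e1 eK /= eqxx.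
have e1 : Point hT = popp (Point hP) by apply: val_inj.
by move: n3p; rewrite -e1 eK /= eqxx.
Qed.

Lemma paddA : associative (@padd k E).
Proof.
move=> P Q R.
case eP: (pval P) => [[x1 y1]|]; last first.
  have -> : P = pzero E by apply: val_inj.
  by rewrite !add0p.
case eQ: (pval Q) => [[x2 y2]|]; last first.
  have -> : Q = pzero E by apply: val_inj.
  by rewrite [padd P (pzero E)]paddC !add0p.
apply: (@regular_dense _ E (fun Q => padd P (padd Q R))
  (fun Q => padd (padd P Q) R) [:: x1] _ _ _ Q x2 y2 eQ).
- apply: regular_add (regular_cst P) _.
  exact: regular_add (@regular_id _ E) (regular_cst R).
- exact: regular_add (regular_addl P) (regular_cst R).
move=> Q' x3 y3 eQ'; rewrite inE eq_sym => n.
exact: paddA_distinct eP eQ' n.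
Qed.

HB.instance Definition _ := GRing.isZmodule.Build (point E)
  paddA (@paddC k E) (@add0p k E) (@addNp k E).

End GroupLaw.

Section Endomorphisms.
Variables (k : closedFieldType) (E : weierstrass k).

Definition is_endo (f : point E -> point E) :=
  {morph f : P Q / P + Q} /\ regular f.

(* The ring of all endomorphisms of E over the algebraically closed field k:
   pointwise addition, and composition as multiplication. *)
Record End := Endo {
  endo_fun :> point E -> point E;
  endo_asboolP : `[< is_endo endo_fun >] }.

HB.instance Definition _ := [isSub for endo_fun].
HB.instance Definition _ := [Choice of End by <:].

Lemma endoP (f : End) : is_endo f.
Proof. exact/asboolP/endo_asboolP. Qed.

Lemma endo_inj (f g : End) : f =1 g -> f = g.
Proof. by move=> fg; apply/val_inj/funext. Qed.

Lemma endoD (f : End) : {morph f : P Q / P + Q}.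
Proof. by have [] := endoP f. Qed.

Fact endo0_subproof : is_endo (fun=> 0).
Proof. by split; [move=> P Q; rewrite addr0 | exact: regular_cst]. Qed.

Fact endo1_subproof : is_endo id.
Proof. by split=> //; exact: regular_id. Qed.

Fact endo_add_subproof (f g : End) : is_endo (fun P => f P + g P).
Proof.
split=> [P Q|]; first by rewrite !endoD addrACA.
exact: (regular_add (endoP f).2 (endoP g).2).
Qed.

Fact endo_opp_subproof (f : End) : is_endo (fun P => - f P).
Proof.
split=> [P Q|]; first by rewrite endoD opprD.
exact: (regular_opp (endoP f).2).
Qed.

Fact endo_mul_subproof (f g : End) : is_endo (f \o g).
Proof.
split=> [P Q|]; first by rewrite /= !endoD.
exact: regular_comp (endoP f).2 (endoP g).2.
Qed.

Definition endo0 := Endo (asboolT endo0_subproof).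
Definition endo1 := Endo (asboolT endo1_subproof).
Definition endo_add f g := Endo (asboolT (endo_add_subproof f g)).
Definition endo_opp f := Endo (asboolT (endo_opp_subproof f)).
Definition endo_mul f g := Endo (asboolT (endo_mul_subproof f g)).

Fact endo_addA : associative endo_add.
Proof. by move=> f g h; apply: endo_inj => P; apply: addrA. Qed.
Fact endo_addC : commutative endo_add.
Proof. by move=> f g; apply: endo_inj => P; apply: addrC. Qed.
Fact endo_add0 : left_id endo0 endo_add.
Proof. by move=> f; apply: endo_inj => P; apply: add0r. Qed.
Fact endo_addN : left_inverse endo0 endo_opp endo_add.
Proof. by move=> f; apply: endo_inj => P; apply: addNr. Qed.

HB.instance Definition _ := GRing.isZmodule.Build End
  endo_addA endo_addC endo_add0 endo_addN.

Fact endo_mulA : associative endo_mul.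
Proof. by move=> f g h; apply: endo_inj. Qed.
Fact endo_mul1l : left_id endo1 endo_mul.
Proof. by move=> f; apply: endo_inj. Qed.
Fact endo_mul1r : right_id endo1 endo_mul.
Proof. by move=> f; apply: endo_inj. Qed.
Fact endo_mulDl : left_distributive endo_mul endo_add.
Proof. by move=> f g h; apply: endo_inj. Qed.
Fact endo_mulDr : right_distributive endo_mul endo_add.
Proof. by move=> f g h; apply: endo_inj => P; apply: endoD. Qed.

HB.instance Definition _ := GRing.Zmodule_isPzRing.Build End
  endo_mulA endo_mul1l endo_mul1r endo_mulDl endo_mulDr.

End Endomorphisms.

Section TensorRat.
Variable R : pzRingType.

(* R ⊗_Z Q, as the set of fractions a / n with a in R and n a positive
   integer; the pair (a, n) stands for a / (n + 1).  The factor l + 1 accounts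
   for the torsion of R, which dies in the tensor product. *)
Definition frac_eq (z w : R * nat) : bool :=
  `[< exists l, z.1 *+ (w.2.+1 * l.+1) = w.1 *+ (z.2.+1 * l.+1) >].

Fact frac_eq_refl : reflexive frac_eq.
Proof. by move=> z; apply/asboolP; exists 0. Qed.

Fact frac_eq_sym : ssrbool.symmetric frac_eq.
Proof. by move=> z w; apply/asboolP/asboolP => -[l h]; exists l. Qed.

Fact frac_eq_trans : transitive frac_eq.
Proof.
move=> w z t /asboolP[l h1] /asboolP[m h2]; apply/asboolP.
exists (w.2.+1 * l.+1 * m.+1).-1; rewrite prednK //.
have -> : (t.2.+1 * (w.2.+1 * l.+1 * m.+1)
  = (w.2.+1 * l.+1) * (t.2.+1 * m.+1))%N by lia.
have -> : (z.2.+1 * (w.2.+1 * l.+1 * m.+1)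
  = (w.2.+1 * m.+1) * (z.2.+1 * l.+1))%N by lia.
by rewrite mulrnA h1 [RHS]mulrnA -h2 -!mulrnA mulnC.
Qed.

Canonical frac_equiv := EquivRel frac_eq frac_eq_refl frac_eq_sym frac_eq_trans.

Definition tensorQ : Type := {eq_quot frac_eq}.
HB.instance Definition _ := Choice.on tensorQ.

Definition frac (a : R) (n : nat) : tensorQ := \pi_{eq_quot frac_eq} (a, n).

Lemma fracP a n b m : reflect
  (exists l, a *+ (m.+1 * l.+1) = b *+ (n.+1 * l.+1)) (frac a n == frac b m).
Proof. by rewrite /frac piE; apply: asboolP. Qed.

Lemma eq_frac a n b m l :
  a *+ (m.+1 * l.+1) = b *+ (n.+1 * l.+1) -> frac a n = frac b m.
Proof. by move=> h; apply/eqP/fracP; exists l. Qed.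

Lemma fracE (z : tensorQ) : exists a n, z = frac a n.
Proof.
exists (repr z).1, (repr z).2; rewrite /frac -surjective_pairing.
by rewrite reprK.
Qed.

Lemma repr_frac a n : exists l, (repr (frac a n)).1 *+ (n.+1 * l.+1)
  = a *+ ((repr (frac a n)).2.+1 * l.+1).
Proof.
have : frac (repr (frac a n)).1 (repr (frac a n)).2 == frac a n.
  by rewrite {1}/frac -surjective_pairing reprK.
by move/fracP.
Qed.

Definition tq_add (z w : tensorQ) := let: (a, n) := repr z in
  let: (b, m) := repr w in frac (a *+ m.+1 + b *+ n.+1) (n.+1 * m.+1).-1.
Definition tq_mul (z w : tensorQ) := let: (a, n) := repr z in
  let: (b, m) := repr w in frac (a * b) (n.+1 * m.+1).-1.
Definition tq_opp (z : tensorQ) := let: (a, n) := repr z in frac (- a) n.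
Definition tq_scale (r : rat) (z : tensorQ) := let: (a, n) := repr z in
  frac (a *~ numq r) (`|denq r|%N * n.+1).-1.

Lemma tq_addE a n b m :
  tq_add (frac a n) (frac b m) = frac (a *+ m.+1 + b *+ n.+1) (n.+1 * m.+1).-1.
Proof.
rewrite /tq_add; have [l] := repr_frac a n; have [l'] := repr_frac b m.
case: (repr (frac a n)) (repr (frac b m)) => [a' n'] [b' m'] /= h2 h1.
apply: (@eq_frac _ _ _ _ (l.+1 * l'.+1).-1); rewrite !prednK //.
rewrite !mulrnDl -!mulrnA.
have -> : (m'.+1 * (n.+1 * m.+1 * (l.+1 * l'.+1))
  = n.+1 * l.+1 * (m'.+1 * m.+1 * l'.+1))%N by lia.
have -> : (n'.+1 * (n.+1 * m.+1 * (l.+1 * l'.+1))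
  = m.+1 * l'.+1 * (n'.+1 * n.+1 * l.+1))%N by lia.
rewrite (mulrnA a' (n.+1 * l.+1)) h1 (mulrnA b' (m.+1 * l'.+1)) h2 -!mulrnA.
by congr (_ *+ _ + _ *+ _); lia.
Qed.

Lemma tq_mulE a n b m :
  tq_mul (frac a n) (frac b m) = frac (a * b) (n.+1 * m.+1).-1.
Proof.
rewrite /tq_mul; have [l] := repr_frac a n; have [l'] := repr_frac b m.
case: (repr (frac a n)) (repr (frac b m)) => [a' n'] [b' m'] /= h2 h1.
apply: (@eq_frac _ _ _ _ (l.+1 * l'.+1).-1); rewrite !prednK //.
have -> : (n.+1 * m.+1 * (l.+1 * l'.+1) = n.+1 * l.+1 * (m.+1 * l'.+1))%N.
  by lia.
have -> : (n'.+1 * m'.+1 * (l.+1 * l'.+1) = n'.+1 * l.+1 * (m'.+1 * l'.+1))%N.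
  by lia.
rewrite [LHS]mulrnA -mulrnAl -mulrnAr h1 h2 mulrnAl mulrnAr -mulrnA.
by congr (_ *+ _); lia.
Qed.

Lemma tq_oppE a n : tq_opp (frac a n) = frac (- a) n.
Proof.
rewrite /tq_opp; have [l] := repr_frac a n.
case: (repr (frac a n)) => [a' n'] /= h.
by apply: (@eq_frac _ _ _ _ l); rewrite !mulNrn h.
Qed.

Lemma den_gt0 r : (0 < `|denq r|)%N.
Proof. by rewrite absz_gt0 denq_neq0. Qed.

Lemma mulrz_swap (V : zmodType) (x : V) z n : x *~ z *+ n = x *+ n *~ z.
Proof. by rewrite !pmulrn -!mulrzA mulrC. Qed.

Lemma tq_scaleE r a n :
  tq_scale r (frac a n) = frac (a *~ numq r) (`|denq r|%N * n.+1).-1.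
Proof.
rewrite /tq_scale; have [l] := repr_frac a n.
case: (repr (frac a n)) => [a' n'] /= h.
apply: (@eq_frac _ _ _ _ l); rewrite !prednK ?muln_gt0 ?den_gt0 // -!mulnA.
by rewrite !mulrz_swap ![(`|denq r| * _)%N]mulnC 2!(mulrnA _ (_ * _)) h.
Qed.

Fact tq_addA : associative tq_add.
Proof.
move=> z w t; have [a [n ->]] := fracE z; have [b [m ->]] := fracE w.
have [c [p ->]] := fracE t; rewrite !tq_addE.
apply: (@eq_frac _ _ _ _ 0); rewrite !prednK // !mulrnDl -!mulrnA addrA.
by congr (_ *+ _ + _ *+ _ + _ *+ _); lia.
Qed.

Fact tq_addC : commutative tq_add.
Proof.
move=> z w; have [a [n ->]] := fracE z; have [b [m ->]] := fracE w.
by rewrite !tq_addE addrC mulnC.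
Qed.

Fact tq_add0 : left_id (frac 0 0) tq_add.
Proof.
move=> z; have [a [n ->]] := fracE z; rewrite tq_addE.
by rewrite mul0rn add0r mul1n.
Qed.

Fact tq_addN : left_inverse (frac 0 0) tq_opp tq_add.
Proof.
move=> z; have [a [n ->]] := fracE z; rewrite tq_oppE tq_addE.
by apply: (@eq_frac _ _ _ _ 0); rewrite mulNrn addNr !mul0rn.
Qed.

HB.instance Definition _ := GRing.isZmodule.Build tensorQ
  tq_addA tq_addC tq_add0 tq_addN.

Fact tq_mulA : associative tq_mul.
Proof.
move=> z w t; have [a [n ->]] := fracE z; have [b [m ->]] := fracE w.
have [c [p ->]] := fracE t; rewrite !tq_mulE !prednK // mulrA.
by rewrite mulnA.
Qed.

Fact tq_mul1l : left_id (frac 1 0) tq_mul.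
Proof.
by move=> z; have [a [n ->]] := fracE z; rewrite tq_mulE mul1r mul1n.
Qed.

Fact tq_mul1r : right_id (frac 1 0) tq_mul.
Proof.
by move=> z; have [a [n ->]] := fracE z; rewrite tq_mulE mulr1 muln1.
Qed.

Fact tq_mulDl : left_distributive tq_mul tq_add.
Proof.
move=> z w t; have [a [n ->]] := fracE z; have [b [m ->]] := fracE w.
have [c [p ->]] := fracE t; rewrite !(tq_addE, tq_mulE).
apply: (@eq_frac _ _ _ _ 0); rewrite !prednK // mulrDl !mulrnDl.
by rewrite !mulrnAl -!mulrnA; congr (_ *+ _ + _ *+ _); lia.
Qed.

Fact tq_mulDr : right_distributive tq_mul tq_add.
Proof.
move=> z w t; have [a [n ->]] := fracE z; have [b [m ->]] := fracE w.
have [c [p ->]] := fracE t; rewrite !(tq_addE, tq_mulE).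
apply: (@eq_frac _ _ _ _ 0); rewrite !prednK // mulrDr !mulrnDl.
by rewrite !mulrnAr -!mulrnA; congr (_ *+ _ + _ *+ _); lia.
Qed.

HB.instance Definition _ := GRing.Zmodule_isPzRing.Build tensorQ
  tq_mulA tq_mul1l tq_mul1r tq_mulDl tq_mulDr.

Lemma fracMn a n p : frac a n *+ p = frac (a *+ p) n.
Proof.
elim: p => [|p IH]; first by apply: (@eq_frac _ _ _ _ 0); rewrite !mul0rn.
rewrite mulrSr IH [LHS]tq_addE; apply: (@eq_frac _ _ _ _ 0).
by rewrite prednK // -mulrnA -mulrnDr -!mulrnA; congr (_ *+ _); lia.
Qed.

Lemma fracMz a n p : frac a n *~ p = frac (a *~ p) n.
Proof. by case: p => p; rewrite ?NegzE ?mulrNz -?pmulrn fracMn // -tq_oppE. Qed.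

Lemma tq_mulIn n (z w : tensorQ) : (0 < n)%N -> z *+ n = w *+ n -> z = w.
Proof.
have [a [m ->]] := fracE z; have [b [p ->]] := fracE w.
case: n => // n _; rewrite !fracMn => /eqP /fracP [l h].
apply: (@eq_frac _ _ _ _ (n.+1 * l.+1).-1); rewrite prednK //.
by rewrite !(mulnCA _ n.+1) !(mulrnA _ n.+1).
Qed.

Lemma tq_scale_den r z : tq_scale r z *+ `|denq r|%N = z *~ numq r.
Proof.
have [a [n ->]] := fracE z; rewrite tq_scaleE fracMn fracMz.
apply: (@eq_frac _ _ _ _ 0); rewrite prednK ?muln_gt0 ?den_gt0 //.
by rewrite -mulrnA !muln1.
Qed.

Lemma tq_scale_char (r : rat) (p : int) (q : nat) z w : (0 < q)%N ->
  r * q%:R = p%:~R -> w *+ q = z *~ p -> tq_scale r z = w.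
Proof.
move=> q0 hr h; apply: (@tq_mulIn (`|denq r|%N * q)).
  by rewrite muln_gt0 den_gt0.
have e : numq r * q%:Z = p * denq r.
  by apply: (@intr_inj rat); rewrite !rmorphM /= numqE -hr mulrAC.
rewrite mulrnA tq_scale_den mulnC [RHS]mulrnA h !pmulrn -!mulrzA e.
by rewrite abszE ger0_norm // denq_ge0.
Qed.

Lemma ratE (r : rat) : r * `|denq r|%N%:R = (numq r)%:~R.
Proof. by rewrite numqE pmulrn abszE ger0_norm ?denq_ge0. Qed.

Fact tq_scaleA r s z : tq_scale r (tq_scale s z) = tq_scale (r * s) z.
Proof.
symmetry; apply: (@tq_scale_char _ (numq s * numq r) (`|denq r| * `|denq s|)%N).
- by rewrite muln_gt0 !den_gt0.
- by rewrite natrM mulrACA !ratE intrM mulrC.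
by rewrite mulrnA tq_scale_den mulrz_swap tq_scale_den mulrzA.
Qed.

Fact tq_scale1 : left_id 1 tq_scale.
Proof. by move=> z; apply: (@tq_scale_char _ 1 1). Qed.

Fact tq_scaleDr : right_distributive tq_scale +%R.
Proof.
move=> r z w; apply: (@tq_scale_char _ (numq r) `|denq r|%N); rewrite ?den_gt0 //.
  exact: ratE.
by rewrite mulrnDl !tq_scale_den mulrzDl.
Qed.

Fact tq_scaleDl z : {morph tq_scale^~ z : r s / r + s}.
Proof.
move=> r s; apply: (@tq_scale_char _
  (numq r * `|denq s|%N%:Z + numq s * `|denq r|%N%:Z) (`|denq r| * `|denq s|)%N).
- by rewrite muln_gt0 !den_gt0.
- by rewrite natrM intrD !intrM -!ratE !pmulrn; ring.
rewrite mulrnDl mulrnA tq_scale_den mulnC mulrnA tq_scale_den mulrzDr.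
by rewrite !mulrzA !pmulrn.
Qed.

HB.instance Definition _ := GRing.Zmodule_isLmodule.Build rat tensorQ
  tq_scaleA tq_scale1 tq_scaleDr tq_scaleDl.

Definition toQ (a : R) : tensorQ := frac a 0.

Fact toQ_additive : zmod_morphism toQ.
Proof.
move=> a b; rewrite /toQ [- frac b 0]tq_oppE [RHS]tq_addE.
by rewrite muln1.
Qed.

Fact toQ_multiplicative : monoid_morphism toQ.
Proof. by split=> // a b; rewrite /toQ [RHS]tq_mulE. Qed.

HB.instance Definition _ := GRing.isZmodMorphism.Build R tensorQ toQ toQ_additive.
HB.instance Definition _ :=
  GRing.isMonoidMorphism.Build R tensorQ toQ toQ_multiplicative.

End TensorRat.

(* R ⊗ Q is a quaternion algebra (a, b | Q), with basis 1, i, j, ij. *)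
Definition quaternion_tensorQ (R : pzRingType) :=
  exists (a b : rat) (i j : tensorQ R),
    [/\ [/\ a != 0, b != 0, i * i = a *: (1 : tensorQ R),
             j * j = b *: (1 : tensorQ R) & j * i = - (i * j)],
        forall z, exists t x y w : rat,
          z = t *: (1 : tensorQ R) + x *: i + y *: j + w *: (i * j) &
        forall t x y w : rat,
          t *: (1 : tensorQ R) + x *: i + y *: j + w *: (i * j) = 0 ->
          [/\ t = 0, x = 0, y = 0 & w = 0]].

(* R is isomorphic to an order in a quaternion algebra over Q. *)
Definition quaternion_order (R : pzRingType) :=
  [/\ quaternion_tensorQ R, injective (@toQ R) &
      exists m (X : m.-tuple R), forall x, inIntSpan X x].

(* Deuring's form of the definition: in characteristic p it is equivalent to
   E having no point of order p. *)
Definition supersingular (k : closedFieldType) (E : weierstrass k) :=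
  quaternion_order (End E).

Section Quadratic.
Variable K : splittingFieldType rat.

Definition imaginary_quadratic :=
  \dim {:K} = 2%N /\
  forall sigma : {rmorphism K -> algC}, ~ forall x, sigma x \is Num.real.

(* The Galois conjugation, i.e. the automorphism of K other than 1, which is
   unique when K is quadratic. *)
Definition galois_conj : gal_of {:K} :=
  odflt 1%g [pick s : gal_of {:K} | s != 1%g].

Definition algebraic_integer (x : K) := integralOver (intr : int -> K) x.

(* P is a prime ideal of the ring of integers of K. *)
Definition prime_ideal (P : K -> Prop) :=
  [/\ forall x, P x -> algebraic_integer x,
      P 0 /\ (forall x y, P x -> P y -> P (x + y)),
      forall x y, algebraic_integer x -> P y -> P (x * y),
      ~ P 1 &
      forall x y, algebraic_integer x -> algebraic_integer y ->
        P (x * y) -> P x \/ P y].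

(* In a quadratic field at most two primes lie above p. *)
Definition splits (p : nat) :=
  exists P Q : K -> Prop, [/\ prime_ideal P /\ prime_ideal Q,
    P p%:R, Q p%:R & ~ (forall x, P x <-> Q x)].

Definition is_order (O : K -> Prop) :=
  [/\ O 1, forall x y, O x -> O y -> O (x * y) &
      exists m (X : m.-tuple K),
        <<X>>%VS = fullv /\ forall x, O x <-> inIntSpan X x].

Definition Zadjoin (w x : K) := exists q : {poly int}, x = (map_poly intr q).[w].

End Quadratic.

Section Orientations.
Variables (k : closedFieldType) (E : weierstrass k) (K : splittingFieldType rat).

(* A K-orientation is a ring embedding iota : K -> End(E) ⊗ Q. *)
Definition primitive (O : K -> Prop) (iota : K -> tensorQ (End E)) :=
  forall z, ((exists x, z = iota x) /\ (exists alpha : End E, z = toQ alpha))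
            <-> (exists2 x, O x & z = iota x).

Definition conj_orientation (iota : K -> tensorQ (End E)) :=
  fun x => iota (galois_conj K x).

(* The composition is taken in End(E) ⊗ Q, where iota w lives. *)
Definition twisting (iota : K -> tensorQ (End E)) (w : K) (alpha : End E) :=
  conj_orientation iota w * toQ alpha = toQ alpha * iota w.

End Orientations.

(* Main.v *)
Require Import Defs.
From mathcomp Require Import all_boot all_order all_algebra all_field.
From mathcomp Require Import boolp ring.
Import GRing.Theory.
Local Open Scope ring_scope.

(** Put z = iota w, and let T and N be the rational trace and norm of w, so that
    z^2 = T z - N and the conjugate of z is T - z.  For every c the commutator
    b = z c - c z satisfies (T - z) b = b z, because both N c and c N cancel.
    As w is not rational and the centre of a quaternion algebra over Q is Q,
    some c does not commute with z, and clearing the denominator of b gives a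
    nonzero twisting endomorphism. *)

Section TensorRatAlgebra.
Context {R : pzRingType}.
Implicit Types (r : rat) (u v z : tensorQ R).

(** [tensorQ R] is torsion-free, so clearing the denominator of [r] determines [r *: v]; identities
    about rational scalars reduce to integer multiples. *)
Lemma tensorQ_scale_char r u v :
  u *+ `|denq r|%N = v *~ numq r -> r *: v = u.
Proof. by apply: tq_scale_char; [exact: den_gt0 | exact: ratE]. Qed.

Lemma tensorQ_scaleAl r u v : r *: u * v = r *: (u * v).
Proof.
apply/esym/tensorQ_scale_char.
by rewrite -mulrnAl [_ *+ _]tq_scale_den mulrzAl.
Qed.

Lemma tensorQ_scaleAr r u v : u * (r *: v) = r *: (u * v).
Proof.
apply/esym/tensorQ_scale_char.
by rewrite -mulrnAr [_ *+ _]tq_scale_den mulrzAr.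
Qed.

(** A ring morphism respects integers, hence also rational scalars, because division by an integer
    is unique in the target. *)
Lemma rmorph_tensorQ_alg (K : splittingFieldType rat)
    (f : {rmorphism K -> tensorQ R}) r : f (r *: (1 : K)) = r *: (1 : tensorQ R).
Proof.
apply/esym/tensorQ_scale_char; rewrite -rmorphMn /= scalerMnl -mulr_natr ratE.
by rewrite scaler_int rmorph_int.
Qed.

(** Lets the identity serve as the nonzero twisting endomorphism when conjugation fixes [w]. *)
Lemma quaternion_one_neq0 : quaternion_tensorQ R -> (1 : R) <> 0.
Proof.
move=> [a [b [i [j [_ _ free]]]]] R10.
have Q10 : (1 : tensorQ R) = 0 by rewrite -(rmorph1 (@toQ R)) R10 rmorph0.
by case: (free 1 0 0 0) => [|/eqP]; rewrite // Q10 !scaler0 !scale0r !addr0.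
Qed.

Lemma quaternion_center z :
  quaternion_tensorQ R -> (forall c, c * z = z * c) -> exists r : rat, z = r *: (1 : tensorQ R).
Proof.
move=> [a [b [i [j [[a0 _ ii _ ji] span free]]]]] zC.
have [t [x [y [u zE]]]] := span z.
have iij : i * (i * j) = a *: j by rewrite mulrA ii tensorQ_scaleAl mul1r.
have iji : i * j * i = - (a *: j) by rewrite -mulrA ji mulrN iij.
(* The commutator of [i] with [z] is [2 u a j + 2 y ij]; its coefficients vanish by freeness. *)
have [_ _ /eqP + /eqP] : [/\ 0 = 0 :> rat, 0 = 0 :> rat, (u + u) * a = 0 & y + y = 0].
  apply: free; rewrite !scale0r !add0r -scalerA !scalerDl.
  move: (zC i); rewrite zE !mulrDr !mulrDl !tensorQ_scaleAr !tensorQ_scaleAl.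
  rewrite mulr1 mul1r ji iij iji !scalerN -!addrA => /addrI /addrI /eqP.
  by rewrite -subr_eq0 opprD !opprK addrACA addrC -addrA => /eqP.
rewrite mulf_eq0 (negPf a0) orbF -!mulr2n !Num.Theory.mulrn_eq0 /= => /eqP u0 /eqP y0.
(* Now [z = t + x i], and its commutator with [j] is [- 2 x ij]. *)
have [_ _ _ /eqP] : [/\ 0 = 0 :> rat, 0 = 0 :> rat, 0 = 0 :> rat & x + x = 0].
  apply: free; rewrite !scale0r !add0r scalerDl.
  move: (zC j); rewrite zE u0 y0 !scale0r !addr0 !mulrDr !mulrDl.
  rewrite !tensorQ_scaleAr !tensorQ_scaleAl mulr1 mul1r ji scalerN.
  by move=> /addrI /eqP; rewrite eq_sym -subr_eq0 opprK => /eqP.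
rewrite -mulr2n Num.Theory.mulrn_eq0 /= => /eqP x0.
by exists t; rewrite zE x0 y0 u0 !scale0r !addr0.
Qed.

End TensorRatAlgebra.

Section QuadraticConjugation.
Context {K : splittingFieldType rat}.
Implicit Types (w : K) (s : gal_of {:K}).

Lemma gal_moved_irrational s w : s w != w -> w \notin 1%VS.
Proof.
apply: contra => /vlineP [r ->].
by rewrite linearZ /= rmorph1.
Qed.

Lemma quadratic_sqr w : \dim {:K} = 2%N -> w \notin 1%VS ->
  exists T N : rat, w * w = T *: w - N *: 1.
Proof.
move=> dimK wQ; have /andP [/eqP wspan _] : basis_of fullv [:: w; 1].
  by rewrite basisEfree free_cons seq1_free oner_neq0 span_seq1 wQ subvf dimK.
have : w * w \in <<[:: w; 1%R]>>%VS by rewrite wspan memvf.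
rewrite span_cons span_seq1 => /memv_addP [_ /vlineP [T ->] [_ /vlineP [N ->] ->]].
by exists T, (- N); rewrite scaleNr opprK.
Qed.

(** Both [w] and [s w] are roots of [X^2 - T X + N]. Subtracting the two equations leaves a product
    with the nonzero factor [s w - w]. *)
Lemma gal_quadratic_conj s w (T N : rat) :
  s w != w -> w * w = T *: w - N *: 1 -> s w = T *: 1 - w.
Proof.
move=> swNw wE; have := congr1 s wE.
rewrite rmorphM rmorphB /= !linearZ /= rmorph1 => swE.
have factor : (s w - w) * (s w + w - T *: 1) = 0.
  have TE (v : K) : v * (T *: 1) = T *: v by rewrite -scalerAr mulr1.
  rewrite mulrBr TE mulrBl !mulrDr [w * s w]mulrC swE wE scalerBr scalerN.
  ring.
move/eqP: factor; rewrite mulf_eq0 subr_eq0 (negPf swNw) /= subr_eq0.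
by move=> /eqP <-; rewrite addrK.
Qed.
End QuadraticConjugation.

Lemma twisting_exists (k : closedFieldType) (E : weierstrass k)
    (K : splittingFieldType rat) (iota : {rmorphism K -> tensorQ (End E)})
    (w : K) :
  quaternion_tensorQ (End E) -> \dim {:K} = 2%N -> injective iota ->
  exists alpha : End E, alpha != 0 /\ twisting iota w alpha.
Proof.
move=> quat dimK iota_inj; rewrite /twisting /conj_orientation.
case: (eqVneq (galois_conj K w) w) => [-> | sw].
  (* A fixed [w] includes the junk case where [galois_conj] defaults to 1. *)
  exists 1; split; first exact/eqP/quaternion_one_neq0.
  by rewrite rmorph1 mulr1 mul1r.
have wQ := gal_moved_irrational _ _ sw.
have [T [N wE]] := quadratic_sqr _ dimK wQ.
rewrite (gal_quadratic_conj _ _ _ _ sw wE) rmorphB /= rmorph_tensorQ_alg.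
set z := iota w.
have zE : z * z = T *: z - N *: (1 : tensorQ (End E)).
  have Tw : iota (T *: w) = T *: z.
    by rewrite -mulr_algl rmorphM /= rmorph_tensorQ_alg tensorQ_scaleAl mul1r.
  by rewrite -rmorphM wE rmorphB /= rmorph_tensorQ_alg Tw.
(* Otherwise [z] is central, hence rational, and injectivity of [iota] makes [w] rational. *)
have [c zc] : exists c, c * z != z * c.
  apply: contrapT => /forallNP zC.
  have [|r zr] := quaternion_center z quat.
    by move=> c; apply/eqP; apply: contrapT => ne; apply: (zC c); apply/negP.
  move/negP: wQ; apply; apply/vlineP; exists r; apply: iota_inj.
  by rewrite rmorph_tensorQ_alg.
pose beta := z * c - c * z.
have beta_twist : (T *: (1 : tensorQ (End E)) - z) * beta = beta * z.
  (* After substituting for [z * z], both sides equal [z c z - T c z + N c]. *)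
  rewrite /beta mulrBl !mulrBr mulrBl tensorQ_scaleAl mul1r.
  rewrite !tensorQ_scaleAl !mul1r !mulrA zE -[c * z * z]mulrA zE.
  rewrite mulrBl mulrBr !tensorQ_scaleAl !tensorQ_scaleAr mul1r mulr1.
  by rewrite !opprB addrC -!addrA addKr.
have [alpha [n betaE]] := fracE beta.
(* [frac alpha n] has denominator [n + 1]. *)
have alphaE : toQ alpha = beta *+ n.+1.
  by rewrite betaE fracMn; apply: (@eq_frac _ _ _ _ _ 0); rewrite !muln1 mulr1n.
exists alpha; split.
  (* If [alpha] were zero, torsion-freeness would give [beta = 0], so [c] would commute with [z]. *)
  apply: contraNneq zc => alpha0.
  rewrite eq_sym -subr_eq0; apply/eqP/(@tq_mulIn _ n.+1) => //.
  by rewrite -/beta -alphaE alpha0 raddf0 mul0rn.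
by rewrite alphaE mulrnAr beta_twist mulrnAl.
Qed.

Theorem theorem2p11
    (p : nat) (p_prime : prime p) (p_gt3 : (3 < p)%N)
    (* k is an algebraic closure of F_p *)
    (k : closedFieldType) (Fp_to_k : {rmorphism 'F_p -> k})
    (k_algebraic : integralRange Fp_to_k)
    (K : splittingFieldType rat) (K_imag : imaginary_quadratic K)
    (p_nonsplit : ~ splits K p)
    (O : K -> Prop) (O_order : is_order O)
    (w : K) (O_gen : forall x, O x <-> Zadjoin w x)
    (E : weierstrass k) (E_supersingular : supersingular E)
    (iota : {rmorphism K -> tensorQ (End E)}) (iota_inj : injective iota)
    (iota_primitive : primitive O iota) :
  exists alpha : End E, alpha != 0 /\ twisting iota w alpha.
Proof.
case: E_supersingular K_imag => quat _ _ [dimK _].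
exact: twisting_exists.
Qed.
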